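(* Let $a,b,c,d,e\in\mathbb{R}$ with $b\neq 0$ and let $\mu\geq -1/2$. (1) If $f\in L^1_\mu(\mathbb{R})$, then the map $w\mapsto \mathcal{D}^{a,b,c}_{d,e,\mu}[f](w)$ is continuous on $\mathbb{R}$, and for all $w\in\mathbb{R}$ $$\left|\mathcal{D}^{a,b,c}_{d,e,\mu}[f](w)\right|\leq \frac{c_\mu}{|ib|^{\mu+1}}\,\|f\|_{\mu,1}.$$ (2) For every $f\in\mathcal{S}(\mathbb{R})$ and all $w\in\mathbb{R}$, $$\mathcal{D}^{a,b,c}_{d,e,\mu}[f](w)=\frac{1}{(ib)^{\mu+1}}\,e^{-i(cw^2+ew)}\,\mathcal{D}_\mu[h](w/b),\qquad\text{where } h(v)=e^{-i(av^2+dv)}f(v).$$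
   Context: For $\mu\ge -1/2$ and $1\le p<\infty$, $L^p_\mu(\mathbb{R})$ is the space of measurable $f:\mathbb{R}\to\mathbb{C}$ with $\|f\|_{\mu,p}=\left(\int_{\mathbb{R}}|f(v)|^p|v|^{2\mu+1}dv\right)^{1/p}<\infty$. $\mathcal{S}(\mathbb{R})$ is the Schwartz space. Put $c_\mu=\frac{1}{2^{\mu+1}\Gamma(\mu+1)}$. The normalized spherical Bessel function is $j_\mu(z)=\Gamma(\mu+1)\sum_{n=0}^{\infty}\frac{(-1)^n (z/2)^{2n}}{n!\,\Gamma(n+\mu+1)}$, and the Dunkl kernel is $E_\mu(iw,v)=j_\mu(wv)+\frac{iwv}{2(\mu+1)}\,j_{\mu+1}(wv)$ for $w,v\in\mathbb{R}$. The Dunkl transform of $f\in L^1_\mu(\mathbb{R})$ is $\mathcal{D}_\mu[f](w)=c_\mu\int_{\mathbb{R}}E_\mu(-iw,v)f(v)|v|^{2\mu+1}dv$. For real $a,b,c,d,e$ with $b\neq0$, the quadratic-phase Dunkl kernel is $\Psi^{a,b,c}_{d,e,\mu}(w,v)=e^{-i(av^2+cw^2+dv+ew)}E_\mu(-iw/b,v)$, and the quadratic-phase Dunkl transform of $f\in L^1_\mu(\mathbb{R})$ is $\mathcal{D}^{a,b,c}_{d,e,\mu}[f](w)=\frac{c_\mu}{(ib)^{\mu+1}}\int_{\mathbb{R}}\Psi^{a,b,c}_{d,e,\mu}(w,v)f(v)|v|^{2\mu+1}dv$. Complex powers are taken with the principal branch. *)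

(* Defs.v *)
From HB Require Import structures.
From mathcomp Require Import all_boot all_order all_algebra.
From mathcomp Require Import all_classical all_reals all_analysis.
Set Implicit Arguments.
Unset Strict Implicit.
Unset Printing Implicit Defensive.
Import Order.TTheory GRing.Theory Num.Theory.
Import numFieldNormedType.Exports.
From mathcomp.real_closed Require Import complex.

Local Open Scope classical_set_scope.
Local Open Scope ring_scope.
Local Open Scope complex_scope.

Section ComplexFunctions.
Context {R : realType}.
Implicit Types z s : R[i].

(* The modulus as an element of R: the library's `|z| lives in R[i]. *)
Definition cmod z : R := Re `|z|.

Definition cexp z : R[i] := (expR (Re z))%:C * (cos (Im z) +i* sin (Im z)).

(* Principal argument, in ]-pi, pi]; only meaningful for z != 0. *)
Definition carg z : R :=
  if 0 <= Im z then acos (Re z / cmod z) else - acos (Re z / cmod z).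

Definition clog z : R[i] := ln (cmod z) +i* carg z.

(* Principal branch; only meaningful for z != 0. *)
Definition cpow z s : R[i] := cexp (s * clog z).

Definition cderiven (n : nat) (f : R -> R[i]) (x : R) : R[i] :=
  derive1n n (fun t => Re (f t)) x +i* derive1n n (fun t => Im (f t)) x.

Definition csmooth (f : R -> R[i]) : Prop :=
  forall n x, derivable (derive1n n (fun t => Re (f t))) x 1 /\
              derivable (derive1n n (fun t => Im (f t))) x 1.

Definition schwartz (f : R -> R[i]) : Prop :=
  csmooth f /\
  forall m n : nat, exists M : R, forall x, `|x| ^+ m * cmod (cderiven n f x) <= M.

End ComplexFunctions.

(* The real line with the sigma-algebra of Lebesgue-measurable sets (the
   library's default one on R is the Borel sigma-algebra). *)
Definition lebesgueType (R : realType) :=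
  caratheodory_type ((@wlength R idfun)^*)%mu.

Section ComplexIntegration.
Context {R : realType}.
Local Notation leb := (@completed_lebesgue_measure R).

Definition cmeasurable (f : R -> R[i]) : Prop :=
  measurable_fun [set: lebesgueType R] (fun v : lebesgueType R => Re (f v)) /\
  measurable_fun [set: lebesgueType R] (fun v : lebesgueType R => Im (f v)).

Definition cintegral (f : R -> R[i]) : R[i] :=
  (\int[leb]_v Re (f v)) +i* (\int[leb]_v Im (f v)).

Definition Lmu_norm (mu p : R) (f : R -> R[i]) : \bar R :=
  ((\int[leb]_v ((cmod (f v) `^ p * `|v| `^ (2 * mu + 1))%R)%:E) `^ p^-1)%E.

Definition Lmu (mu p : R) (f : R -> R[i]) : Prop :=
  cmeasurable f /\ (Lmu_norm mu p f < +oo)%E.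

End ComplexIntegration.

Section Dunkl.
Context {R : realType}.
Implicit Types a b c d e mu w v x z : R.

(* Euler's integral, only meaningful for x > 0. *)
Definition Gamma x : R :=
  \int[@lebesgue_measure R]_(t in `]0, +oo[%classic) (t `^ (x - 1) * expR (- t)).

Definition c_ mu : R := (2 `^ (mu + 1) * Gamma (mu + 1))^-1.

(* Only real arguments are needed, so the series is taken in R. *)
Definition bessel_j mu z : R :=
  Gamma (mu + 1) *
  limn (series (fun n : nat =>
    (-1) ^+ n * (z / 2) ^+ (2 * n) / (n`!%:R * Gamma (n%:R + mu + 1)))).

(* dunklE mu w v is E_mu(i w, v). *)
Definition dunklE mu w v : R[i] :=
  (bessel_j mu (w * v))%:C +
  'i%C * (w * v)%:C / (2 * (mu + 1))%:C * (bessel_j (mu + 1) (w * v))%:C.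

Definition dunkl_transform mu (f : R -> R[i]) w : R[i] :=
  (c_ mu)%:C *
  cintegral (fun v => dunklE mu (- w) v * f v * (`|v| `^ (2 * mu + 1))%:C).

Definition qp_kernel a b c d e mu w v : R[i] :=
  cexp (- 'i%C * (a * v ^+ 2 + c * w ^+ 2 + d * v + e * w)%:C) *
  dunklE mu (- (w / b)) v.

Definition qp_dunkl_transform a b c d e mu (f : R -> R[i]) w : R[i] :=
  (c_ mu)%:C / cpow ('i%C * b%:C) (mu + 1)%:C *
  cintegral (fun v =>
    qp_kernel a b c d e mu w v * f v * (`|v| `^ (2 * mu + 1))%:C).

End Dunkl.

(* Main.v *)
Require Import Defs.
From mathcomp Require Import all_boot all_order all_algebra.
From mathcomp Require Import all_classical all_reals all_analysis.
Import Order.TTheory GRing.Theory Num.Theory.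
Import numFieldNormedType.Exports.
From mathcomp.real_closed Require Import complex.
From mathcomp Require Import measurable_realfun lra ring.
Set Implicit Arguments.
Unset Strict Implicit.
Unset Printing Implicit Defensive.
Local Open Scope classical_set_scope.
Local Open Scope ring_scope.
Local Open Scope complex_scope.

(** Everything rests on the bound [cmod (dunklE mu w v) <= 1] for
    [- (1 / 2) <= mu]. Write [u x = bessel_j mu x] and
    [s x = x / (2 * (mu + 1)) * bessel_j (mu + 1) x], so that the Dunkl kernel
    is [u + 'i * s] at [x = w * v]. Comparing power series gives the system

      [u' = - s]    and    [x * s' + (2 * mu + 1) * s = x * u]

    ([is_derive_bessel_j], [is_derive_bessel_odd]). Hence
    [x * (u ^+ 2 + s ^+ 2)' = - 2 * (2 * mu + 1) * s ^+ 2 <= 0], so the squared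
    modulus is nonincreasing on the positive half-line, with value 1 at the
    origin; being even, it is at most 1 everywhere ([sqr_bessel_le1]). This energy
    argument replaces the usual integral representation of the kernel.

    Turning the Bessel series, whose coefficients involve values of Gamma, into
    a hypergeometric one requires that Gamma be finite, positive, and satisfy
    its functional equation on the positive half-line ([Gamma_gt0], [GammaD1]);
    these follow from an integration by parts on compact intervals exhausting
    the half-line.

    The phase has modulus 1, so the integrand of the quadratic-phase transform
    is dominated by the weighted modulus of [f]. This gives the norm bound
    through [le_cmod_cintegral], and the continuity in [w] by dominated
    convergence ([continuous_integral_weighted]). Finally, a Schwartz function
    decays fast enough to be integrable against the weight
    ([schwartz_Lmu]), so that the factor of the kernel which depends on [w]
    alone can be taken out of the integral ([cintegralZl]), and what remains is
    the Dunkl transform at [w / b]. *)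

(** * The Gamma function on the positive half-line *)

Lemma powR_le1Dexpn (R : realType) (s t : R) (n : nat) :
  0 <= s <= n%:R -> 0 <= t -> t `^ s <= 1 + t ^+ n.
Proof.
move=> /andP[s0 sn] t0; have [t1|t1] := leP t 1.
  rewrite (le_trans (y := 1))//; last by rewrite lerDl exprn_ge0.
  by rewrite (le_trans (ge0_ler_powR s0 _ _ t1)) ?powR1 ?nnegrE.
rewrite (le_trans (y := t ^+ n))//; last by rewrite lerDr.
by rewrite -powR_mulrn// ler_powR// ltW.
Qed.

Section GammaFunction.
Context {R : realType}.
Local Notation leb := (@lebesgue_measure R).
Implicit Types (x t a b : R).

Definition gamma_fun x t := t `^ (x - 1) * expR (- t).

Lemma gamma_fun_ge0 x t : 0 <= gamma_fun x t.
Proof. by rewrite mulr_ge0 ?powR_ge0 ?expR_ge0. Qed.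

Lemma measurable_gamma_fun x D : measurable_fun D (gamma_fun x).
Proof.
apply: measurable_funTS; apply: measurable_funM; first exact: measurable_powR.
by apply: measurableT_comp => //; exact: oppr_measurable.
Qed.

(** Half of the exponential decay of [expR (- t)] absorbs the power of [t], by
    comparing [(t / 2) ^+ n / n`!] with [expR (t / 2)]. *)
Lemma gamma_fun_dominated x : 1 <= x ->
  exists2 C : R, 0 <= C & forall t, 0 <= t -> gamma_fun x t <= C * expR (- t / 2).
Proof.
move=> x1; set n := (Num.truncn (x - 1)).+1.
exists (1 + n`!%:R * 2 ^+ n); first by rewrite addr_ge0// mulr_ge0.
move=> t t0; rewrite /gamma_fun.
have -> : - t / 2 = t / 2 + - t by lra.
rewrite expRD mulrA ler_wpM2r ?expR_ge0//.
have h : x - 1 <= n%:R by rewrite ltW// truncnS_gt.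
rewrite (le_trans (@powR_le1Dexpn _ (x - 1) t n _ t0)) ?subr_ge0 ?x1//.
have e1 := @expR_ge1Dxn _ (t / 2) n.-1 (divr_ge0 t0 (ler0n _ 2)).
have e2 : 1 <= expR (t / 2) by rewrite -[leLHS]expR0 ler_expR divr_ge0.
rewrite mulrDl mul1r lerD//.
have {}e1 : (t / 2) ^+ n / n`!%:R <= expR (t / 2).
  by apply: le_trans e1; rewrite lerDr.
apply: le_trans (ler_wpM2l _ e1); last by rewrite mulr_ge0.
rewrite expr_div_n [leRHS](_ : _ = t ^+ n)//; field.
by rewrite expf_neq0//= pnatr_eq0 -lt0n fact_gt0.
Qed.

(** Euler's integral with values in the extended reals: [Gamma] is its image
    under [fine], which is informative only once finiteness is known. *)
Definition egamma x : \bar R :=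
  (\int[leb]_(t in `]0%R, +oo[) (gamma_fun x t)%:E)%E.

Lemma egamma_ge0 x : (0 <= egamma x)%E.
Proof. by apply: integral_ge0 => t _; rewrite lee_fin gamma_fun_ge0. Qed.

Lemma egamma_lty_ge1 x : 1 <= x -> (egamma x < +oo)%E.
Proof.
move=> /gamma_fun_dominated[C C0 hC].
(* The dominating function is a multiple of the density of the exponential
   distribution of rate 1/2, whose integral is 1. *)
have r0 : (0 < 2^-1 :> R) by [].
apply: (@le_lt_trans _ _
   (\int[leb]_(t in `]0%R, +oo[) ((2 * C)%:E * (exponential_pdf 2^-1 t)%:E))%E).
  apply: ge0_le_integral => //.
  - by move=> t _; rewrite lee_fin gamma_fun_ge0.
  - by apply/measurable_EFinP; exact: measurable_gamma_fun.
  - apply: measurable_funTS; apply: emeasurable_funM => //.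
    by apply/measurable_EFinP; exact: measurable_exponential_pdf.
  - move=> t /=; rewrite in_itv/= andbT => t0.
    rewrite -EFinM lee_fin exponential_pdfE; last exact: ltW.
    apply: le_trans (hC _ (ltW t0)) _.
    by rewrite mulrACA divff// mul1r !mulNr [t * _]mulrC.
rewrite ge0_integralZl//=.
- rewrite lte_mul_pinfty// ?lee_fin ?mulr_ge0//.
  apply: (@le_lt_trans _ _ (\int[leb]_t (exponential_pdf 2^-1 t)%:E)%E).
    apply: ge0_subset_integral => //.
    by apply/measurable_EFinP; exact: measurable_exponential_pdf.
    by move=> t _; rewrite lee_fin exponential_pdf_ge0// ltW.
  by rewrite integral_exponential_pdf// ltry.
- by apply/measurable_EFinP/measurable_funTS; exact: measurable_exponential_pdf.
- by move=> t _; rewrite lee_fin exponential_pdf_ge0// ltW.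
- by rewrite lee_fin mulr_ge0.
Qed.

Lemma continuous_powR_gt0 x t : 0 < t -> {for t, continuous (@powR R ^~ x)}.
Proof.
move=> t0; apply: differentiable_continuous; apply/derivable1_diffP.
by apply: derivable_powR; rewrite in_itv/= t0.
Qed.

(** Integrating by parts away from the singularity at 0 gives the functional
    equation of Gamma up to boundary terms. *)
Lemma gamma_fun_by_parts x a b : 0 < a -> a < b ->
  (x%:E * \int[leb]_(t in `[a, b]) (gamma_fun x t)%:E =
   \int[leb]_(t in `[a, b]) (gamma_fun (x + 1) t)%:E +
   (gamma_fun (x + 1) b - gamma_fun (x + 1) a)%:E)%E.
Proof.
move=> a0 ab.
have pos t : t \in `[a, b] -> 0 < t.
  by rewrite in_itv/= => /andP[+ _]; exact: lt_le_trans.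
have pos' t : t \in `]a, b[ -> 0 < t.
  by rewrite in_itv/= => /andP[+ _]; exact: lt_trans.
have cE t : {for t, continuous (fun t : R => expR (- t))}.
  by apply: continuous_comp; [exact: continuousN|exact: continuous_expR].
have dE t : is_derive t 1 (fun t : R => expR (- t)) (- expR (- t)).
  by apply: is_derive_eq; rewrite /GRing.scale/=; ring.
have cg y : {within `[a, b], continuous (gamma_fun y)}.
  apply: continuous_in_subspaceT => t /set_mem/= /pos t0.
  by apply: cvgM; [exact: continuous_powR_gt0|exact: cE].
have ig y : leb.-integrable `[a, b] (fun t => (gamma_fun y t)%:E).
  by apply: continuous_compact_integrable => //; exact: segment_compact.
rewrite -(@integralZl _ _ _ leb `[a, b] _ _ (ig x))//.
under eq_integral => t _ do rewrite -EFinM mulrA [X in (X)%:E]mulrC.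
rewrite (@integration_by_parts _ (fun t => expR (- t)) (@powR R ^~ x)
  (fun t => - expR (- t)) (fun t => x * t `^ (x - 1)))//.
- rewrite addeC /gamma_fun !addrK; congr (_ + _)%E.
    by rewrite ![expR _ * _]mulrC.
  under eq_integral do rewrite mulNr EFinN mulrC.
  rewrite integralN/= ?oppeK//.
  apply: integrable_add_def => //.
  by have := ig (x + 1); rewrite /gamma_fun addrK.
- by apply: continuous_in_subspaceT => t _; apply: cvgN; exact: cE.
- split.
  + by move=> t _; exact: ex_derive.
  + by apply: cvg_at_right_filter; exact: cE.
  + by apply: cvg_at_left_filter; exact: cE.
- by move=> t _; rewrite derive1E; exact: derive_val.
- apply: continuous_in_subspaceT => t /set_mem/= /pos t0.
  by apply: cvgM; [exact: cvg_cst|exact: continuous_powR_gt0].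
- split.
  + by move=> t /pos' t0; apply: derivable_powR; rewrite in_itv/= t0.
  + apply: cvg_at_right_filter; exact: continuous_powR_gt0.
  + apply: cvg_at_left_filter; apply: continuous_powR_gt0; exact: lt_trans ab.
- by move=> t /pos' t0; rewrite derive1E; have [_ ->] := is_derive1_powR x t0.
Qed.

(** The boundary term at infinity is [n.+1%:R^-1] times the bounded quantity
    [gamma_fun (x + 2) n.+1%:R]. *)
Lemma gamma_fun_cvgy x : 0 <= x ->
  gamma_fun (x + 1) n.+1%:R @[n --> \oo] --> 0.
Proof.
move=> x0; have [|C C0 hC] := @gamma_fun_dominated (x + 1 + 1).
  by rewrite lerDr addr_ge0.
apply: (@squeeze_cvgr _ _ _ _ (cst 0) (fun n => C * n.+1%:R^-1)).
- apply: nearW => n; rewrite /cst gamma_fun_ge0/= ler_pdivlMr//.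
  apply: le_trans (le_trans (hC n.+1%:R (ler0n _ _)) _).
    rewrite /gamma_fun !addrK mulrAC powRD ?powRr1// pnatr_eq0 implybT//.
  rewrite -[leRHS]mulr1 ler_wpM2l// expR_le1 mulNr oppr_le0.
- exact: cvg_cst.
- rewrite -[X in _ --> X](mulr0 C); apply: cvgM; first exact: cvg_cst.
  exact: cvg_harmonic.
Qed.

Lemma gamma_fun_cvg0 x : 0 < x ->
  gamma_fun (x + 1) n.+1%:R^-1 @[n --> \oo] --> 0.
Proof.
move=> x0.
have h : (fun n : nat => n.+1%:R^-1 : R) @ \oo --> (0 : R)^'+.
  move=> A hA.
  have h : \forall n \near \oo, 0 < (n.+1%:R^-1 : R) -> A n.+1%:R^-1.
    exact: @cvg_harmonic R _ hA.
  suff : \forall n \near \oo, A (n.+1%:R^-1 : R) by [].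
  by apply: filterS h => n; apply; rewrite invr_gt0.
apply: (@squeeze_cvgr _ _ _ _ (cst 0) (fun n => n.+1%:R^-1 `^ x)).
- apply: nearW => n; rewrite gamma_fun_ge0/= /gamma_fun addrK.
  rewrite -[leRHS]mulr1 ler_wpM2l ?powR_ge0// expR_le1 oppr_le0.
- exact: cvg_cst.
- exact: (cvg_comp _ _ h (powR_cvg0 x0)).
Qed.

(** Compact intervals exhausting the half-line, on which [gamma_fun x] is
    continuous for every [x]. *)
Definition gamma_itv (n : nat) : set R := `[n.+1%:R^-1, n.+1%:R].

Lemma egamma_cvg x :
  (\int[leb]_(t in gamma_itv n) (gamma_fun x t)%:E)%E @[n --> \oo] -->
  egamma x.
Proof.
have -> : egamma x =
    (\int[leb]_(t in \bigcup_n gamma_itv n) (gamma_fun x t)%:E)%E.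
  congr integral; apply/seteqP; split=> t /=.
    rewrite in_itv/= andbT => t0.
    exists (Num.truncn (t + t^-1)) => //=.
    rewrite /gamma_itv /= in_itv/=.
    have := truncnS_gt (t + t^-1) => h; apply/andP; split.
      rewrite invf_ple ?posrE//; apply/ltW/(le_lt_trans _ h).
      by rewrite lerDr ltW.
    by apply/ltW/(le_lt_trans _ h); rewrite lerDl invr_ge0 ltW.
  move=> [n _]; rewrite /gamma_itv /= !in_itv/= andbT => /andP[+ _].
  by apply: lt_le_trans; rewrite invr_gt0.
apply: ge0_nondecreasing_set_cvg_integral => //.
- apply/nondecreasing_seqP => n; rewrite subsetEset => t.
  rewrite /gamma_itv/= !in_itv/= => /andP[a b]; apply/andP; split.
    by apply: le_trans a; rewrite lef_pV2 ?posrE// ler_nat.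
  by apply: le_trans b _; rewrite ler_nat.
- by move=> n; exact: measurable_itv.
- by move=> n; apply/measurable_EFinP; exact: measurable_gamma_fun.
- by move=> n t _; rewrite lee_fin gamma_fun_ge0.
Qed.

(** The identity is proved in the extended reals, where the right-hand side
    makes sense even though [egamma x] is not yet known to be finite for
    [x < 1]; its finiteness is then a consequence. *)
Lemma egammaD1 x : 0 < x -> egamma (x + 1) = (x%:E * egamma x)%E.
Proof.
move=> x0.
have hx : (x%:E * \int[leb]_(t in gamma_itv n) (gamma_fun x t)%:E)%E
    @[n --> \oo] --> (x%:E * egamma x)%E.
  by apply: cvgeZl => //; exact: egamma_cvg.
have hb : (gamma_fun (x + 1) n.+1%:R - gamma_fun (x + 1) n.+1%:R^-1)%:E
    @[n --> \oo] --> 0%:E.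
  apply: cvg_EFin; first exact: nearW.
  rewrite -[X in _ --> X]subr0; apply: cvgB; last exact: gamma_fun_cvg0.
  exact: gamma_fun_cvgy (ltW x0).
have fin : egamma (x + 1) \is a fin_num.
  by rewrite ge0_fin_numE ?egamma_ge0// egamma_lty_ge1// lerDr ltW.
have := @cvgeD _ _ _ _ _ _ _ _ (fin_num_adde_defr _ fin) (@egamma_cvg (x + 1)) hb.
have FF : Filter \oo by exact: eventually_filter.
rewrite adde0 => /(_ FF) h.
rewrite -(cvg_lim (@ereal_hausdorff R) h); apply/cvg_lim => //.
apply: cvg_trans hx; apply: near_eq_cvg; near=> n.
have n0 : (0 < n)%N by near: n; exists 1%N.
apply: gamma_fun_by_parts; first by rewrite invr_gt0.
by rewrite (@lt_trans _ _ 1) ?invf_lt1 ?ltr1n.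
Unshelve. all: by end_near. Qed.

Lemma egamma_lty x : 0 < x -> (egamma x < +oo)%E.
Proof.
move=> x0; have : (egamma (x + 1) < +oo)%E.
  by apply: egamma_lty_ge1; rewrite lerDr ltW.
rewrite egammaD1//; have := egamma_ge0 x.
by case: (egamma x) => [r _ _||]; rewrite ?ltry// gt0_muley ?ltxx// lte_fin.
Qed.

(** By the functional equation it suffices to bound the integral at [x + 1]
    from below, and there the integrand is at least [expR (- 2)] on [[1, 2]]. *)
Lemma egamma_gt0 x : 0 < x -> (0 < egamma x)%E.
Proof.
move=> x0; suff: (0 < egamma (x + 1))%E by rewrite egammaD1// pmule_rgt0// lte_fin.
apply: (@lt_le_trans _ _ (\int[leb]_(t in `[1%R, 2%R]) (expR (- 2))%:E)%E).
  rewrite integral_cst//= lebesgue_measure_itv/= lte_fin ltr1n/=.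
  by rewrite -EFinB -EFinM lte_fin mulr_gt0 ?expR_gt0// subr_gt0 ltr1n.
apply: (@le_trans _ _ (\int[leb]_(t in `[1%R, 2%R]) (gamma_fun (x + 1) t)%:E)%E).
  apply: ge0_le_integral => //.
  - by apply/measurable_EFinP; exact: measurable_gamma_fun.
  - move=> t /=; rewrite in_itv/= => /andP[t1 t2]; rewrite lee_fin.
    rewrite -[leLHS]mul1r ler_pM ?expR_ge0 ?ler_expR ?lerN2//.
    by rewrite addrK -(powRr0 t) ler_powR// ltW.
apply: ge0_subset_integral => //.
- by apply/measurable_EFinP; exact: measurable_gamma_fun.
- by move=> t _; rewrite lee_fin gamma_fun_ge0.
- move=> t /=; rewrite !in_itv/= andbT => /andP[+ _]; exact: lt_le_trans.
Qed.

Lemma Gamma_gt0 x : 0 < x -> 0 < Gamma x.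
Proof. by move=> x0; rewrite fine_gt0// egamma_gt0//= egamma_lty. Qed.

Lemma GammaD1 x : 0 < x -> Gamma (x + 1) = x * Gamma x.
Proof.
move=> x0; rewrite /Gamma /Rintegral -!/(egamma _) egammaD1// fineM//.
by rewrite ge0_fin_numE ?egamma_ge0 ?egamma_lty.
Qed.

Lemma c_ge0 (mu : R) : 0 <= c_ mu.
Proof.
rewrite invr_ge0 mulr_ge0 ?powR_ge0//; apply: Rintegral_ge0 => t _.
by rewrite mulr_ge0 ?powR_ge0 ?expR_ge0.
Qed.

End GammaFunction.

(** * Bessel functions and the energy estimate *)

Section BesselFunction.
Context {R : realType}.
Implicit Types (mu m x y : R) (n : nat).

(** The coefficient of [y ^+ n] in the Bessel series in the variable
    [y = (x / 2) ^+ 2], the quotient of Gamma values being a Pochhammer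
    symbol; in this form it obeys a one-step recursion in [n]. *)
Definition bessel_coef m n : R :=
  \prod_(k < n) - ((k.+1%:R * (m + k.+1%:R))^-1).

Definition bessel_phi m y : R := limn (pseries (bessel_coef m) y).

Lemma bessel_coefS m n :
  bessel_coef m n.+1 = bessel_coef m n * - (n.+1%:R * (m + n.+1%:R))^-1.
Proof. by rewrite /bessel_coef big_ord_recr. Qed.

Lemma bessel_coef_bound m n : -1 < m ->
  `|bessel_coef m n| <= (m + 1)^-1 ^+ n / n`!%:R.
Proof.
move=> m1; have m10 : 0 < m + 1 by lra.
elim: n => [|n IHn].
  by rewrite /bessel_coef big_ord0 normr1 expr0 fact0 divr1.
have hp : 0 < m + n.+1%:R.
  by apply: (lt_le_trans m10); rewrite lerD2l ler1n.
rewrite bessel_coefS normrM normrN.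
have -> : (m + 1)^-1 ^+ n.+1 / n.+1`!%:R =
    (m + 1)^-1 ^+ n / n`!%:R * (n.+1%:R^-1 * (m + 1)^-1).
  by rewrite exprSr factS natrM invfM; ring.
apply: ler_pM => //; rewrite normfV ger0_norm ?mulr_ge0 ?(ltW hp)// invfM.
by rewrite ler_wpM2l// lef_pV2 ?posrE// lerD2l ler1n.
Qed.

Lemma is_cvg_bessel m y : -1 < m -> cvgn (pseries (bessel_coef m) y).
Proof.
move=> m1; have m10 : 0 < (m + 1)^-1 by rewrite invr_gt0; lra.
apply: normed_cvg.
apply: (series_le_cvg _ _ _ (@is_cvg_series_exp_coeff R (`|y| / (m + 1)))) => n /=.
- by [].
- by rewrite /exp_coeff/= divr_ge0// exprn_ge0// mulr_ge0// ltW.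
- rewrite normrM normrX /exp_coeff/= exprMn mulrC -mulrA ler_wpM2l ?exprn_ge0//.
  exact: bessel_coef_bound.
Qed.

(** The contiguity relation between the coefficients of parameters [m] and
    [m + 1]; both [is_derive_bessel_phi] and [bessel_phi_rec] come from it. *)
Lemma bessel_coef_shift m n : -1 < m ->
  (m + 1) * bessel_coef m n = (m + 1 + n%:R) * bessel_coef (m + 1) n.
Proof.
move=> m1; elim: n => [|n IHn].
  by rewrite /bessel_coef !big_ord0 addr0.
have n0 : 0 <= n%:R :> R by [].
rewrite !bessel_coefS mulrA IHn -[n.+1]addn1 natrD.
field.
by apply/and3P; split; apply: lt0r_neq0; lra.
Qed.

Lemma pseries_diffs_bessel m : -1 < m ->
  pseries_diffs (bessel_coef m) = (- (m + 1)^-1) \*: bessel_coef (m + 1).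
Proof.
move=> m1; apply/funext => n; rewrite /pseries_diffs /= bessel_coefS.
have n0 : 0 <= n%:R :> R by [].
rewrite /GRing.scale/= -[n.+1]addn1 natrD.
have -> : bessel_coef (m + 1) n = (m + 1) * bessel_coef m n / (m + 1 + n%:R).
  by rewrite bessel_coef_shift// mulrAC mulfV ?mul1r//; apply: lt0r_neq0; lra.
field.
by apply/and3P; split; apply: lt0r_neq0; lra.
Qed.

Lemma pseriesZ (k : R) (c : R^nat) y :
  pseries (k \*: c) y = (fun n => k * pseries c y n).
Proof.
apply/funext => n; rewrite /pseries /= /series/= mulr_sumr.
by apply: eq_bigr => i _; rewrite mulrA.
Qed.

Lemma is_derive_bessel_phi m y : -1 < m ->
  is_derive y 1 (bessel_phi m) (- (m + 1)^-1 * bessel_phi (m + 1) y).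
Proof.
move=> m1.
have m2 : -1 < m + 1 by lra.
have m3 : -1 < m + 1 + 1 by lra.
have dE k l z : -1 < l ->
    pseries (k \*: bessel_coef l) z @ \oo --> k * bessel_phi l z.
  move=> l1; rewrite pseriesZ.
  by apply: cvgM; [exact: cvg_cst|exact: is_cvg_bessel].
have -> : - (m + 1)^-1 * bessel_phi (m + 1) y =
    limn (pseries (pseries_diffs (bessel_coef m)) y).
  apply/esym/cvg_lim => //; rewrite pseries_diffs_bessel//; exact: dE.
apply: (@pseries_snd_diffs _ _ (`|y| + 1)).
- exact: is_cvg_bessel.
- rewrite pseries_diffs_bessel//; apply: cvgP; exact: dE.
- rewrite pseries_diffs_bessel//.
  rewrite (_ : pseries_diffs _ =
      - (m + 1)^-1 \*: pseries_diffs (bessel_coef (m + 1))).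
    rewrite pseries_diffs_bessel//.
    rewrite (_ : _ \*: (_ \*: _) =
      (- (m + 1)^-1 * - (m + 1 + 1)^-1) \*: bessel_coef (m + 1 + 1)); last first.
      by apply/funext => n /=; rewrite scalerA.
    by apply: cvgP; exact: dE.
  by apply/funext => n; rewrite /pseries_diffs /= /GRing.scale/= mulrCA.
- by rewrite [ltRHS]ger0_norm ?ltrDl// addr_ge0.
Qed.

(** Summing [bessel_coef_shift] over [n]: the factor [n] produces the
    derivative of [bessel_phi (m + 1)], which is a multiple of
    [bessel_phi (m + 2)]. *)
Lemma bessel_phi_rec m y : -1 < m ->
  (m + 1) * bessel_phi m y =
  (m + 1) * bessel_phi (m + 1) y - y * ((m + 2)^-1 * bessel_phi (m + 2) y).
Proof.
move=> m1; have m2 : -1 < m + 1 by lra.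
have m3 : -1 < m + 1 + 1 by lra.
have cv k : -1 < k -> pseries (bessel_coef k) y @ \oo --> bessel_phi k y.
  by move=> k1; exact: is_cvg_bessel.
have cd : pseries (pseries_diffs (bessel_coef (m + 1))) y @ \oo -->
    - (m + 2)^-1 * bessel_phi (m + 2) y.
  rewrite pseries_diffs_bessel// (_ : m + 2 = m + 1 + 1); last by ring.
  by rewrite pseriesZ; apply: cvgM; [exact: cvg_cst|exact: cv].
have := pseries_diffs_equiv (cvgP _ cd).
rewrite (cvg_lim _ cd)// => {}cd.
have l1 : (fun n => (m + 1) * pseries (bessel_coef m) y n) @ \oo -->
    (m + 1) * bessel_phi m y.
  by apply: cvgM; [exact: cvg_cst|exact: cv].
rewrite -(cvg_lim _ l1)//; apply/cvg_lim => //.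
rewrite -mulrN -mulNr.
rewrite (_ : (fun n => _) = (fun n => (m + 1) * pseries (bessel_coef (m + 1)) y n
   + y * series (fun n => n%:R * bessel_coef (m + 1) n * y ^+ n.-1) n)); last first.
  apply/funext => n; rewrite /pseries/= /series/= !mulr_sumr -big_split/=.
  apply: eq_bigr => -[|i] _.
    by rewrite mulrA bessel_coef_shift// !mul0r mulr0 !addr0 mulrA.
  by rewrite mulrA bessel_coef_shift//= exprS; ring.
apply: cvgD.
  by apply: cvgM; [exact: cvg_cst|exact: cv].
by apply: cvgM; [exact: cvg_cst|exact: cd].
Qed.

Lemma bessel_phi0 m : bessel_phi m 0 = 1.
Proof.
rewrite /bessel_phi; apply/cvg_lim => //.
apply: cvg_near_cst; near=> n; rewrite /pseries/series/=.
have n0 : (0 < n)%N by near: n; exists 1%N.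
rewrite -(prednK n0) big_nat_recl// /bessel_coef big_ord0 expr0 mul1r.
by rewrite big1 ?addr0// => i _; rewrite expr0n mulr0.
Unshelve. all: by end_near. Qed.

Lemma Gamma_bessel_coef mu n : -1 < mu ->
  Gamma (mu + 1) * ((-1) ^+ n / (n`!%:R * Gamma (n%:R + mu + 1))) =
  bessel_coef mu n.
Proof.
move=> m1; have G0 k : Gamma (k%:R + mu + 1) != 0.
  have k0 : 0 <= k%:R :> R by [].
  by apply/lt0r_neq0/Gamma_gt0; lra.
elim: n => [|n IHn].
  rewrite /bessel_coef big_ord0 expr0 fact0 mul1r add0r mul1r mulfV//.
  by have := G0 0%N; rewrite add0r.
rewrite bessel_coefS -IHn.
have -> : n.+1%:R + mu + 1 = (n%:R + mu + 1) + 1.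
  by rewrite -[n.+1]addn1 natrD; ring.
have p : 0 < n%:R + mu + 1.
  by have n0 : 0 <= n%:R :> R by []; lra.
rewrite (GammaD1 p) exprS factS natrM.
have -> : mu + n.+1%:R = n%:R + mu + 1.
  by rewrite -[n.+1]addn1 natrD; ring.
field.
by rewrite G0 (lt0r_neq0 p) nat1r !pnatr_eq0 -!lt0n fact_gt0.
Qed.

Lemma bessel_jE mu x : -1 < mu ->
  bessel_j mu x = bessel_phi mu ((x / 2) ^+ 2).
Proof.
move=> m1; have G0 : Gamma (mu + 1) != 0 by apply/lt0r_neq0/Gamma_gt0; lra.
rewrite /bessel_j (_ : series _ =
    (fun n => (Gamma (mu + 1))^-1 * pseries (bessel_coef mu) ((x / 2) ^+ 2) n)).
  rewrite (@cvg_lim _ _ _ _ _ _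
    ((Gamma (mu + 1))^-1 * bessel_phi mu ((x / 2) ^+ 2)))//.
    by rewrite mulVKf.
  by apply: cvgM; [exact: cvg_cst|exact: is_cvg_bessel].
apply/funext => n; rewrite /pseries/= /series/= mulr_sumr; apply: eq_bigr => i _.
by rewrite -Gamma_bessel_coef// mulrA mulKf// -exprM mulrAC.
Qed.

(** The Dunkl kernel is [bessel_j mu + 'i * bessel_odd mu] at [w * v]. *)
Definition bessel_odd mu x := x / (2 * (mu + 1)) * bessel_j (mu + 1) x.

Lemma is_derive_bessel_j mu x : -1 < mu ->
  is_derive x 1 (bessel_j mu) (- bessel_odd mu x).
Proof.
move=> m1; have m2 : -1 < mu + 1 by lra.
have -> : bessel_j mu = bessel_phi mu \o (fun x => (x / 2) ^+ 2).
  by apply/funext => z; rewrite /= bessel_jE.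
rewrite /bessel_odd bessel_jE//.
have h1 : is_derive x 1 (fun x : R => (x / 2) ^+ 2) (x / 2).
  by apply: is_derive_eq; rewrite /GRing.scale/=; field.
have h2 := is_derive_bessel_phi ((x / 2) ^+ 2) m1.
have := @is_derive1_comp _ (bessel_phi mu)
  (fun x => (x / 2) ^+ 2) _ _ _ h2 h1.
set A := _ * _; set B := - _ ; suff -> : A = B by [].
by rewrite /A /B; field; apply: lt0r_neq0; lra.
Qed.

(** The second half of the first-order system satisfied by [bessel_j mu] and
    [bessel_odd mu]. It is multiplied by [x], the equation
    [s' + (2 * mu + 1) / x * s = u] being singular at 0. *)
Lemma is_derive_bessel_odd mu x : - (1 / 2) <= mu -> exists2 s' : R,
  is_derive x 1 (bessel_odd mu) s' &
  x * s' + (2 * mu + 1) * bessel_odd mu x = x * bessel_j mu x.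
Proof.
move=> hmu; have m1 : -1 < mu by lra.
have m2 : -1 < mu + 1 by lra.
have m3 : -1 < mu + 1 + 1 by lra.
have d := is_derive_bessel_j x m2.
exists ((2 * (mu + 1))^-1 * bessel_j (mu + 1) x -
  x / (2 * (mu + 1)) * bessel_odd (mu + 1) x).
  rewrite -mulrN /bessel_odd.
  (* The Bessel functions are abstracted, so that the search for the
     derivative does not unfold them. *)
  move: d; move: (- bessel_odd _ _) => g'; move: (bessel_j _) => g d.
  by apply: is_derive_eq; rewrite /GRing.scale/=; ring.
rewrite /bessel_odd /GRing.scale/= !bessel_jE//.
have := bessel_phi_rec ((x / 2) ^+ 2) m1.
set p0 := bessel_phi _ _.
rewrite (_ : mu + 2 = mu + 1 + 1); last by ring.
set p1 := bessel_phi _ _.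
set p2 := bessel_phi _ _.
move=> h.
have mu0 : mu + 1 != 0 by apply: lt0r_neq0; lra.
have mu10 : mu + 1 + 1 != 0 by apply: lt0r_neq0; lra.
have -> : p0 = p1 - ((x / 2) ^+ 2 * ((mu + 1 + 1)^-1 * p2)) / (mu + 1).
  by apply: (mulfI mu0); rewrite h; field; rewrite ?mu0 ?mu10.
field.
by apply/andP; split; apply: lt0r_neq0; lra.
Qed.

Lemma bessel_jN mu x : -1 < mu -> bessel_j mu (- x) = bessel_j mu x.
Proof. by move=> m1; rewrite !bessel_jE// mulNr sqrrN. Qed.

Lemma bessel_oddN mu x : -1 < mu -> bessel_odd mu (- x) = - bessel_odd mu x.
Proof.
by move=> m1; rewrite /bessel_odd bessel_jN ?mulNr//; lra.
Qed.

Lemma bessel_j0 mu : -1 < mu -> bessel_j mu 0 = 1.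
Proof. by move=> m1; rewrite bessel_jE// mul0r expr0n bessel_phi0. Qed.

(** The energy [V = u ^+ 2 + s ^+ 2], with [u = bessel_j mu] and
    [s = bessel_odd mu], satisfies [x * V' = - 2 * (2 * mu + 1) * s ^+ 2]: the
    cross terms cancel. Since [2 * mu + 1 >= 0], [V] is nonincreasing on the
    half-line, where it starts from [V 0 = 1], and it is even. *)
Lemma sqr_bessel_le1 mu x : - (1 / 2) <= mu ->
  bessel_j mu x ^+ 2 + bessel_odd mu x ^+ 2 <= 1.
Proof.
move=> hmu; have m1 : -1 < mu by lra.
wlog x0 : x / 0 <= x => [wh|].
  have [/wh//|/ltW] := leP 0 x.
  by rewrite -oppr_ge0 => /wh; rewrite bessel_jN// bessel_oddN// sqrrN.
pose V x := bessel_j mu x ^+ 2 + bessel_odd mu x ^+ 2.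
have dV (z : R) : exists2 v' : R, is_derive z 1 V v' &
    z * v' = - (2 * (2 * mu + 1)) * bessel_odd mu z ^+ 2.
  have du := is_derive_bessel_j z m1.
  have [s' ds hs] := is_derive_bessel_odd z hmu.
  exists (2 * bessel_j mu z * (- bessel_odd mu z) + 2 * bessel_odd mu z * s').
    rewrite /V; move: du ds.
    move: (- bessel_odd mu z) => u'.
    move: (bessel_j mu) (bessel_odd mu) => u s du ds.
    by apply: is_derive_eq; rewrite /GRing.scale/=; ring.
  rewrite mulrDr [X in _ + X]mulrCA [X in _ + _ * X](_ : _ =
      z * bessel_j mu z - (2 * mu + 1) * bessel_odd mu z).
    by ring.
  by rewrite -hs addrK.
have : V x <= V 0.
  apply: (@ler0_derive1_nincry _ V 0) => //.
  - by move=> z _; have [v' [] ] := dV z.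
  - move=> z; rewrite in_itv/= andbT => z0; rewrite derive1E.
    have [v' [_ ->] h] := dV z.
    rewrite -(ler_pM2l z0) h mulr0 mulNr oppr_le0 mulr_ge0 ?sqr_ge0//; lra.
  - apply: continuous_subspaceT => z.
    apply/differentiable_continuous/derivable1_diffP.
    by have [v' [] ] := dV z.
by rewrite /V /bessel_odd bessel_j0// !mul0r expr1n expr0n addr0.
Qed.

Lemma continuous_bessel_j mu : -1 < mu -> continuous (bessel_j mu).
Proof.
move=> m1 z; apply/differentiable_continuous/derivable1_diffP.
by have [] := is_derive_bessel_j z m1.
Qed.

Lemma continuous_bessel_odd mu : -1 < mu -> continuous (bessel_odd mu).
Proof.
move=> m1 z; apply: cvgM; last by apply: continuous_bessel_j; lra.
by apply: cvgM; [exact: cvg_id|exact: cvg_cst].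
Qed.

End BesselFunction.

(** * Complex modulus and complex-valued integrals *)

Section ComplexModulus.
Context {R : realType}.
Implicit Types (z : R[i]) (x y : R).

Lemma cmodE z : cmod z = Num.sqrt (Re z ^+ 2 + Im z ^+ 2).
Proof. by case: z. Qed.

Lemma normc_cmod z : `|z| = (cmod z)%:C.
Proof. by case: z. Qed.

Lemma cmod_ge0 z : 0 <= cmod z.
Proof. by rewrite cmodE sqrtr_ge0. Qed.

Lemma ReM z1 z2 : Re (z1 * z2) = Re z1 * Re z2 - Im z1 * Im z2.
Proof. by case: z1 z2 => [a b] [c d]. Qed.

Lemma ImM z1 z2 : Im (z1 * z2) = Re z1 * Im z2 + Im z1 * Re z2.
Proof. by case: z1 z2 => [a b] [c d]. Qed.

Lemma cmodM z1 z2 : cmod (z1 * z2) = cmod z1 * cmod z2.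
Proof. by apply: complexI; rewrite rmorphM -!normc_cmod normrM. Qed.

Lemma cmodV z : cmod z^-1 = (cmod z)^-1.
Proof. by apply: complexI; rewrite fmorphV -!normc_cmod normfV. Qed.

Lemma cmod_real x : cmod x%:C = `|x|.
Proof. by rewrite cmodE /= expr0n addr0 sqrtr_sqr. Qed.

Lemma cmod_eq0 z : (cmod z == 0) = (z == 0).
Proof. by rewrite -(inj_eq (@complexI R)) -normc_cmod normr_eq0. Qed.

Lemma normr_Re_le_cmod z : `|Re z| <= cmod z.
Proof.
by rewrite cmodE -sqrtr_sqr ler_wsqrtr// lerDl sqr_ge0.
Qed.

Lemma normr_Im_le_cmod z : `|Im z| <= cmod z.
Proof.
by rewrite cmodE -sqrtr_sqr ler_wsqrtr// lerDr sqr_ge0.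
Qed.

Lemma cmod_le_ReDIm z : cmod z <= `|Re z| + `|Im z|.
Proof.
rewrite cmodE -[leRHS]ger0_norm ?addr_ge0// -sqrtr_sqr ler_wsqrtr//.
by rewrite sqrrD !real_normK ?num_real// lerD2r lerDl mulrn_wge0// mulr_ge0.
Qed.

Lemma cauchy_schwarz_cmod x y z :
  x * Re z + y * Im z <= cmod (x +i* y) * cmod z.
Proof.
rewrite (le_trans (ler_norm _))// !cmodE -sqrtrM ?addr_ge0 ?sqr_ge0//=.
rewrite -sqrtr_sqr ler_wsqrtr// -subr_ge0.
have -> : (x ^+ 2 + y ^+ 2) * (Re z ^+ 2 + Im z ^+ 2) - (x * Re z + y * Im z) ^+ 2
  = (x * Im z - y * Re z) ^+ 2 by ring.
exact: sqr_ge0.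
Qed.

Lemma cmod_cexp z : cmod (cexp z) = expR (Re z).
Proof.
rewrite /cexp cmodM cmod_real ger0_norm ?expR_ge0// cmodE /= cos2Dsin2.
by rewrite sqrtr1 mulr1.
Qed.

Lemma cmod_cpow z x : z != 0 -> cmod (cpow z x%:C) = cmod z `^ x.
Proof.
move=> z0; rewrite /cpow cmod_cexp /clog /= mul0r subr0.
by rewrite /powR cmod_eq0 (negbTE z0).
Qed.

Lemma cexpNi x : cexp (- 'i%C * x%:C) = cos x -i* sin x.
Proof.
rewrite /cexp /= !(mulr0, mul0r, oppr0, addr0, subr0, add0r, sub0r, mulN1r).
rewrite expR0 mul1r.
by rewrite cosN sinN.
Qed.

Lemma cexpNiD x y :
  cexp (- 'i%C * (x + y)%:C) = cexp (- 'i%C * x%:C) * cexp (- 'i%C * y%:C).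
Proof.
rewrite !cexpNi cosD sinD; apply/eqP; rewrite eq_complex /=.
by apply/andP; split; apply/eqP; ring.
Qed.

Lemma continuous_complex (F : R -> R[i]) :
  continuous (fun x => Re (F x)) -> continuous (fun x => Im (F x)) ->
  continuous (F : R -> (R[i] : numFieldType)).
Proof.
move=> cRe cIm x; apply/cvgrPdist_lt => e.
case: e => e e'; rewrite ltcE /= => /andP[/eqP -> e0].
have e20 : 0 < e / 2 by rewrite divr_gt0.
near=> t.
rewrite normc_cmod complexr0 ltcR (le_lt_trans (cmod_le_ReDIm _))//.
rewrite [e]splitr ltrD//.
- rewrite raddfB; near: t; move/cvgrPdist_lt : (cRe x); exact.
- rewrite raddfB; near: t; move/cvgrPdist_lt : (cIm x); exact.
Unshelve. all: by end_near. Qed.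

End ComplexModulus.

Section ComplexIntegral.
Context {R : realType}.
Local Notation leb := (@completed_lebesgue_measure R).
Implicit Types (f g : R -> R[i]) (h : R -> R).

Lemma measurable_fun_lebesgueType h :
  measurable_fun [set: measurableTypeR R] (h : measurableTypeR R -> R) ->
  measurable_fun [set: lebesgueType R] (h : lebesgueType R -> R).
Proof.
move=> mh _ Y mY; rewrite setTI.
have := mh measurableT Y mY; rewrite setTI.
exact: sub_caratheodory.
Qed.

Lemma continuous_measurable_lebesgueType h : continuous h ->
  measurable_fun [set: lebesgueType R] (h : lebesgueType R -> R).
Proof.
by move=> ch; apply: measurable_fun_lebesgueType; exact: continuous_measurable_fun.
Qed.

(** On Borel sets the completed Lebesgue measure is the Lebesgue measure, that
    is, the latter is the push-forward of the former along the identity. *)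
Lemma ge0_integral_lebesgueType h : measurable_fun [set: measurableTypeR R] h ->
  (forall x, 0 <= h x) ->
  (\int[leb]_x (h x)%:E = \int[@lebesgue_measure R]_x (h x)%:E)%E.
Proof.
move=> mh h0.
pose phi (x : lebesgueType R) : measurableTypeR R := x.
have mid : measurable_fun [set: lebesgueType R] phi.
  move=> _ Y mY; rewrite setTI; exact: sub_caratheodory.
have := @ge0_integral_pushforward _ _ _ _ R phi mid leb setT
  (fun x => (h x)%:E) measurableT.
rewrite preimage_setT => <-//; last 2 first.
- exact/measurable_EFinP.
- by move=> x _; rewrite lee_fin.
Qed.

Lemma measurable_cmod f : cmeasurable f ->
  measurable_fun [set: lebesgueType R] (fun x : lebesgueType R => cmod (f x)).
Proof.
move=> [mR mI].
under eq_fun do rewrite cmodE.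
apply: (measurableT_comp (f := @Num.sqrt R)).
  exact: (continuous_measurable_fun (@sqrt_continuous R)).
by apply: measurable_funD; exact: measurable_funX.
Qed.

Lemma cmeasurableM f g : cmeasurable f -> cmeasurable g ->
  cmeasurable (fun x => f x * g x).
Proof.
move=> [fR fI] [gR gI]; split.
- under eq_fun do rewrite ReM.
  by apply: measurable_funB; exact: measurable_funM.
- under eq_fun do rewrite ImM.
  by apply: measurable_funD; exact: measurable_funM.
Qed.

Lemma cmeasurable_real h :
  measurable_fun [set: lebesgueType R] (h : lebesgueType R -> R) ->
  cmeasurable (fun x => (h x)%:C).
Proof. by move=> mh; split => //=; exact: measurable_cst. Qed.

Lemma continuous_cmeasurable f : continuous (fun x => Re (f x)) ->
  continuous (fun x => Im (f x)) -> cmeasurable f.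
Proof. by move=> cR cI; split; exact: continuous_measurable_lebesgueType. Qed.

Lemma integrable_scale (r : R) h : leb.-integrable setT (EFin \o h) ->
  leb.-integrable setT (EFin \o (fun x => r * h x)).
Proof. by move=> /(integrableZl measurableT r). Qed.

Definition cintegrable f :=
  leb.-integrable setT (EFin \o (fun x => Re (f x))) /\
  leb.-integrable setT (EFin \o (fun x => Im (f x))).

Lemma cmod_cintegrable f : cmeasurable f ->
  (\int[leb]_x (cmod (f x))%:E < +oo)%E -> cintegrable f.
Proof.
move=> mf foo; have [mR mI] := mf.
have ic : leb.-integrable setT (fun x => (cmod (f x))%:E).
  apply/integrableP; split; first exact/measurable_EFinP/measurable_cmod.
  by under eq_integral do rewrite gee0_abs ?lee_fin ?cmod_ge0//.
have main h : measurable_fun [set: lebesgueType R] (h : lebesgueType R -> R) ->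
    (forall x, `|h x| <= cmod (f x)) -> leb.-integrable setT (EFin \o h).
  move=> mh hf; apply: (le_integrable measurableT _ _ ic).
    exact/measurable_EFinP.
  by move=> x _; rewrite /= lee_fin [leRHS]ger0_norm ?cmod_ge0.
split; apply: main => // x.
- exact: normr_Re_le_cmod.
- exact: normr_Im_le_cmod.
Qed.

Lemma cintegralZl (k : R[i]) f : cintegrable f ->
  cintegral (fun x => k * f x) = k * cintegral f.
Proof.
move=> [iR iI]; rewrite /cintegral.
under eq_Rintegral do rewrite ReM.
under [in X in _ +i* X]eq_Rintegral do rewrite ImM.
rewrite RintegralB//; [|exact: integrable_scale..].
rewrite RintegralD//; [|exact: integrable_scale..].
by rewrite !RintegralZl//; case: k.
Qed.

(** With [z] the value of the integral, [cmod z ^+ 2] is the integral of the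
    scalar product of [z] and [f x], which Cauchy-Schwarz bounds by
    [cmod z * cmod (f x)]; then divide by [cmod z]. *)
Lemma le_cmod_cintegral f : cmeasurable f ->
  (\int[leb]_x (cmod (f x))%:E < +oo)%E ->
  ((cmod (cintegral f))%:E <= \int[leb]_x (cmod (f x))%:E)%E.
Proof.
move=> mf foo; have [iR iI] := cmod_cintegrable mf foo.
set z := cintegral f; have [->|z0] := eqVneq (cmod z) 0.
  by apply: integral_ge0 => x _; rewrite lee_fin cmod_ge0.
have zp : 0 < cmod z by rewrite lt0r z0 cmod_ge0.
have ic : leb.-integrable setT (EFin \o (fun x => cmod (f x))).
  apply/integrableP; split; first exact/measurable_EFinP/measurable_cmod.
  by under eq_integral do rewrite gee0_abs ?lee_fin ?cmod_ge0//.
have : cmod z ^+ 2 <= cmod z * \int[leb]_x cmod (f x).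
  have -> : cmod z ^+ 2 = \int[leb]_x (Re z * Re (f x) + Im z * Im (f x)).
    rewrite RintegralD//; [|exact: integrable_scale..]; rewrite !RintegralZl//.
    by rewrite cmodE sqr_sqrtr ?addr_ge0 ?sqr_ge0.
  rewrite -RintegralZl//; apply: le_Rintegral => //.
  - exact: (integrableD measurableT (integrable_scale (Re z) iR)
      (integrable_scale (Im z) iI)).
  - exact: integrable_scale.
  - move=> x _; case: (z) => u v; exact: cauchy_schwarz_cmod.
rewrite expr2 ler_pM2l// => h.
rewrite -[leRHS]fineK ?lee_fin//.
exact: integrable_fin_num ic.
Qed.

End ComplexIntegral.

(** * The Dunkl kernel and dominated transforms *)

Section DunklKernel.
Context {R : realType}.
Implicit Types (a b c d e mu w v x : R).

Lemma dunklE_bessel mu w v :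
  dunklE mu w v = bessel_j mu (w * v) +i* bessel_odd mu (w * v).
Proof.
rewrite /dunklE /bessel_odd -fmorphV.
move: (_^-1) (w * v) => r x; move: (bessel_j mu x) (bessel_j (mu + 1) x) => j j'.
by apply/eqP; rewrite eq_complex /=; apply/andP; split; apply/eqP; ring.
Qed.

Lemma cmod_dunklE_le1 mu w v : - (1 / 2) <= mu -> cmod (dunklE mu w v) <= 1.
Proof.
move=> hmu; rewrite dunklE_bessel.
rewrite cmodE -[leRHS]sqrtr1 ler_wsqrtr//=.
exact: sqr_bessel_le1.
Qed.

Lemma cmod_qp_kernel_le1 a b c d e mu w v : - (1 / 2) <= mu ->
  cmod (qp_kernel a b c d e mu w v) <= 1.
Proof.
move=> hmu; rewrite /qp_kernel cmodM cmod_cexp /=.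
rewrite !(mulr0, mul0r, oppr0, addr0, subr0).
by rewrite expR0 mul1r cmod_dunklE_le1.
Qed.

(** Both the phase and the Bessel argument of the quadratic-phase kernel are
    polynomial in [w] and in [v]; this lemma gives at once the continuity in
    [w] and the measurability in [v]. *)
Lemma continuous_phase_bessel mu (th arg : R -> R) : -1 < mu ->
  continuous th -> continuous arg ->
  let K t := cexp (- 'i%C * (th t)%:C) *
             (bessel_j mu (arg t) +i* bessel_odd mu (arg t)) in
  continuous (fun t => Re (K t)) /\ continuous (fun t => Im (K t)).
Proof.
move=> m1 cth carg K.
have ccos : continuous (cos \o th).
  by move=> t; apply: continuous_comp; [exact: cth|exact: continuous_cos].
have csin : continuous (sin \o th).
  by move=> t; apply: continuous_comp; [exact: cth|exact: continuous_sin].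
have cj : continuous (bessel_j mu \o arg).
  by move=> t; apply: continuous_comp; [exact: carg|exact: continuous_bessel_j].
have cs : continuous (bessel_odd mu \o arg).
  by move=> t; apply: continuous_comp; [exact: carg|exact: continuous_bessel_odd].
have -> : (fun t => Re (K t)) =
    (cos \o th) * (bessel_j mu \o arg) + (sin \o th) * (bessel_odd mu \o arg).
  by apply/funext => t; rewrite /K cexpNi ReM /= mulNr opprK.
have -> : (fun t => Im (K t)) =
    (cos \o th) * (bessel_odd mu \o arg) - (sin \o th) * (bessel_j mu \o arg).
  by apply/funext => t; rewrite /K cexpNi ImM /= mulNr.
split=> t.
  by apply: cvgD; apply: cvgM; [exact: ccos|exact: cj|exact: csin|exact: cs].
by apply: cvgB; apply: cvgM; [exact: ccos|exact: cs|exact: csin|exact: cj].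
Qed.

Lemma qp_kernelE a b c d e mu w v :
  qp_kernel a b c d e mu w v =
  cexp (- 'i%C * (a * v ^+ 2 + c * w ^+ 2 + d * v + e * w)%:C) *
  (bessel_j mu (- (w / b) * v) +i* bessel_odd mu (- (w / b) * v)).
Proof. by rewrite /qp_kernel dunklE_bessel. Qed.

Lemma continuous_qp_kernel a b c d e mu v : -1 < mu ->
  continuous (fun w => Re (qp_kernel a b c d e mu w v)) /\
  continuous (fun w => Im (qp_kernel a b c d e mu w v)).
Proof.
move=> m1.
have cth : continuous (fun w => a * v ^+ 2 + c * w ^+ 2 + d * v + e * w).
  move=> w; repeat (first [exact: cvg_cst | exact: cvg_id
    | exact: exprn_continuous | apply: cvgD | apply: cvgM]).
have carg : continuous (fun w => - (w / b) * v).
  move=> w; apply: cvgM; last exact: cvg_cst.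
  by apply: cvgN; apply: cvgM; [exact: cvg_id|exact: cvg_cst].
have [cR cI] := continuous_phase_bessel m1 cth carg.
by split; under eq_fun do rewrite qp_kernelE.
Qed.

Lemma cmeasurable_qp_kernel a b c d e mu w : -1 < mu ->
  cmeasurable (qp_kernel a b c d e mu w).
Proof.
move=> m1.
have cth : continuous (fun v => a * v ^+ 2 + c * w ^+ 2 + d * v + e * w).
  move=> v; repeat (first [exact: cvg_cst | exact: cvg_id
    | exact: exprn_continuous | apply: cvgD | apply: cvgM]).
have carg : continuous (fun v => - (w / b) * v).
  by move=> v; apply: cvgM; [exact: cvg_cst|exact: cvg_id].
have [cR cI] := continuous_phase_bessel m1 cth carg.
by apply: continuous_cmeasurable; under eq_fun do rewrite qp_kernelE.
Qed.

Lemma qp_kernel_phase a b d mu w v :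
  qp_kernel a b 0 d 0 mu w v =
  cexp (- 'i%C * (a * v ^+ 2 + d * v)%:C) * dunklE mu (- (w / b)) v.
Proof.
rewrite /qp_kernel (_ : _ + 0 * w = a * v ^+ 2 + d * v); last by ring.
by [].
Qed.

(** Only the factor depending on [w] alone comes out of the integral. *)
Lemma qp_kernel_split a b c d e mu w v :
  qp_kernel a b c d e mu w v =
  cexp (- 'i%C * (c * w ^+ 2 + e * w)%:C) * qp_kernel a b 0 d 0 mu w v.
Proof.
rewrite qp_kernel_phase mulrA -cexpNiD /qp_kernel.
by congr (cexp (_ * _%:C) * _); ring.
Qed.

End DunklKernel.

Section WeightedL1.
Context {R : realType}.
Local Notation leb := (@completed_lebesgue_measure R).
Implicit Types (mu w v p : R) (f K : R -> R[i]).

Lemma Lmu_norm1E mu f :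
  Lmu_norm mu 1 f = (\int[leb]_v (cmod (f v) * `|v| `^ (2 * mu + 1))%:E)%E.
Proof.
rewrite /Lmu_norm invr1 poweRe1; last first.
  by apply: integral_ge0 => v _; rewrite lee_fin mulr_ge0 ?powR_ge0.
by apply: eq_integral => v _; rewrite powRr1// cmod_ge0.
Qed.

Lemma cmeasurable_weight p : cmeasurable (fun v : R => (`|v| `^ p)%:C).
Proof.
apply/cmeasurable_real/measurable_fun_lebesgueType.
apply: (measurableT_comp (f := @powR R ^~ p)); first exact: measurable_powR.
exact: normr_measurable.
Qed.

Lemma cmod_weight p v : cmod (`|v| `^ p)%:C = `|v| `^ p.
Proof. by rewrite cmod_real ger0_norm ?powR_ge0. Qed.

Definition weighted mu K f v := K v * f v * (`|v| `^ (2 * mu + 1))%:C.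

Lemma cmeasurable_weighted mu K f : cmeasurable K -> cmeasurable f ->
  cmeasurable (weighted mu K f).
Proof.
move=> mK mf; apply: cmeasurableM; last exact: cmeasurable_weight.
exact: cmeasurableM.
Qed.

Lemma cmod_weighted_le mu K f v : cmod (K v) <= 1 ->
  cmod (weighted mu K f v) <= cmod (f v) * `|v| `^ (2 * mu + 1).
Proof.
move=> K1; rewrite /weighted !cmodM cmod_weight ler_wpM2r ?powR_ge0//.
by rewrite -[leRHS]mul1r ler_wpM2r ?cmod_ge0.
Qed.

Lemma integral_cmod_weighted_le mu K f : cmeasurable K ->
  (forall v, cmod (K v) <= 1) -> cmeasurable f ->
  (\int[leb]_v (cmod (weighted mu K f v))%:E <= Lmu_norm mu 1 f)%E.
Proof.
move=> mK K1 mf; rewrite Lmu_norm1E; apply: ge0_le_integral => //.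
- by move=> v _; rewrite lee_fin cmod_ge0.
- by apply/measurable_EFinP; apply: measurable_cmod; exact: cmeasurable_weighted.
- apply/measurable_EFinP; apply: measurable_funM; first exact: measurable_cmod.
  exact: (cmeasurable_weight _).1.
- by move=> v _; rewrite lee_fin cmod_weighted_le.
Qed.

Lemma cintegrable_weighted mu K f : cmeasurable K ->
  (forall v, cmod (K v) <= 1) -> Lmu mu 1 f -> cintegrable (weighted mu K f).
Proof.
move=> mK K1 [mf foo]; apply: cmod_cintegrable; first exact: cmeasurable_weighted.
exact: le_lt_trans (integral_cmod_weighted_le mu mK K1 mf) foo.
Qed.

Lemma le_cmod_cintegral_weighted mu K f : cmeasurable K ->
  (forall v, cmod (K v) <= 1) -> Lmu mu 1 f ->
  ((cmod (cintegral (weighted mu K f)))%:E <= Lmu_norm mu 1 f)%E.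
Proof.
move=> mK K1 [mf foo].
have le := integral_cmod_weighted_le mu mK K1 mf.
apply: le_trans le; apply: le_cmod_cintegral; first exact: cmeasurable_weighted.
exact: le_lt_trans (integral_cmod_weighted_le mu mK K1 mf) foo.
Qed.

Lemma Lmu_integrable mu f : Lmu mu 1 f ->
  leb.-integrable setT (EFin \o (fun v => cmod (f v) * `|v| `^ (2 * mu + 1))).
Proof.
move=> [mf foo]; apply/integrableP; split.
  apply/measurable_EFinP; apply: measurable_funM; first exact: measurable_cmod.
  exact: (cmeasurable_weight _).1.
move: foo; rewrite Lmu_norm1E; congr (_ < _)%E; apply: eq_integral => v _ /=.
by congr EFin; rewrite [RHS]ger0_norm// mulr_ge0 ?cmod_ge0 ?powR_ge0.
Qed.

(** Continuity under the integral sign: for a kernel of modulus at most 1, the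
    weighted modulus of [f] dominates the integrand uniformly in [w]. *)
Lemma continuous_integral_weighted mu (K : R -> R -> R[i]) f :
  (forall w, cmeasurable (K w)) -> (forall w v, cmod (K w v) <= 1) ->
  (forall v, continuous (fun w => Re (K w v)) /\ continuous (fun w => Im (K w v))) ->
  Lmu mu 1 f ->
  continuous (fun w => \int[leb]_v Re (weighted mu (K w) f v)) /\
  continuous (fun w => \int[leb]_v Im (weighted mu (K w) f v)).
Proof.
move=> mK K1 cK Lf.
have main (g : R -> R -> R) :
    (forall w, leb.-integrable setT (EFin \o g w)) ->
    (forall v, continuous (g ^~ v)) ->
    (forall w v, `|g w v| <= cmod (f v) * `|v| `^ (2 * mu + 1)) ->
    continuous (fun w => \int[leb]_v g w v).
  move=> ig cg gb w.
  have := @continuity_under_integral R _ _ leb g setT measurableT (w - 1) (w + 1).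
  move=> /(_ _ _ _ (Lmu_integrable Lf) _ w); apply => //.
  - by apply: aeW => v _ x _; exact: cg.
  - by move=> x _; apply: aeW => v _; exact: gb.
  - by rewrite inE/= in_itv/= ltrBlDr ltrDl ltr01.
have cfw v : continuous (fun w => Re (weighted mu (K w) f v)) /\
    continuous (fun w => Im (weighted mu (K w) f v)).
  have [cR cI] := cK v.
  split.
    under eq_fun do rewrite /weighted -mulrA ReM.
    by move=> w; apply: cvgB; apply: cvgM; (exact: cvg_cst || exact: cR || exact: cI).
  under eq_fun do rewrite /weighted -mulrA ImM.
  by move=> w; apply: cvgD; apply: cvgM; (exact: cvg_cst || exact: cR || exact: cI).
split; apply: main.
- by move=> w; have [] := cintegrable_weighted (mK w) (K1 w) Lf.
- by move=> v; have [] := cfw v.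
- move=> w v; apply: le_trans (normr_Re_le_cmod _) _.
  exact: cmod_weighted_le.
- by move=> w; have [] := cintegrable_weighted (mK w) (K1 w) Lf.
- by move=> v; have [] := cfw v.
- move=> w v; apply: le_trans (normr_Im_le_cmod _) _.
  exact: cmod_weighted_le.
Qed.

End WeightedL1.

(** * Schwartz functions *)

Section Schwartz.
Context {R : realType}.
Local Notation leb := (@completed_lebesgue_measure R).
Implicit Types (f : R -> R[i]) (x : R).

Lemma integral_oneDsqrV_lty : (\int[leb]_x ((oneDsqr x)^-1)%:E < +oo)%E.
Proof.
have ge0 x : 0 <= (oneDsqr x)^-1 :> R.
  by rewrite invr_ge0 (le_trans ler01)// oneDsqr_ge1.
rewrite ge0_integral_lebesgueType//; last first.
  by apply: continuous_measurable_fun; exact: continuous_oneDsqrV.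
rewrite ge0_symfun_integralT//; last 2 first.
- exact: continuous_oneDsqrV.
- by move=> x; rewrite /oneDsqr /= sqrrN.
by rewrite -set_itvcy integral0y_oneDsqr -EFinM ltry.
Qed.

Lemma cderiven0 f : cderiven 0 f = f.
Proof. by apply/funext => x; rewrite /cderiven/=; case: (f x). Qed.

Lemma schwartz_continuous f : schwartz f ->
  continuous (fun x => Re (f x)) /\ continuous (fun x => Im (f x)).
Proof.
move=> [sf _]; split=> x; have [dR dI] := sf 0%N x;
  exact/differentiable_continuous/derivable1_diffP.
Qed.

Lemma schwartz_weight_decay f p : 0 <= p -> schwartz f ->
  exists2 C, 0 <= C & forall x, cmod (f x) * `|x| `^ p <= C * (oneDsqr x)^-1.
Proof.
move=> p0 [_ decay]; set n := (Num.truncn p).+1.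
have pn : p <= n%:R by rewrite ltW// truncnS_gt.
(* The four monomials of [(1 + `|x| ^+ n) * (1 + `|x| ^+ 2)], a majorant of
   [`|x| `^ p * oneDsqr x]. *)
have [M0 h0] := decay 0%N 0%N; have [M1 h1] := decay n 0%N.
have [M2 h2] := decay 2 0%N; have [M3 h3] := decay (n + 2)%N 0%N.
rewrite cderiven0 in h0 h1 h2 h3.
have bound x : cmod (f x) * `|x| `^ p * oneDsqr x <= M0 + M1 + M2 + M3.
  have -> : oneDsqr x = 1 + `|x| ^+ 2 by rewrite /oneDsqr real_normK ?num_real.
  apply: (@le_trans _ _ (cmod (f x) * (1 + `|x| ^+ n) * (1 + `|x| ^+ 2))).
    rewrite ler_wpM2r ?addr_ge0 ?sqr_ge0// ler_wpM2l ?cmod_ge0//.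
    by rewrite powR_le1Dexpn ?p0.
  have := lerD (lerD (lerD (h0 x) (h1 x)) (h2 x)) (h3 x).
  apply: le_trans; rewrite le_eqVlt; apply/orP; left; apply/eqP.
  by rewrite exprD; ring.
exists (M0 + M1 + M2 + M3).
  apply: le_trans (bound 0); rewrite !mulr_ge0 ?cmod_ge0 ?powR_ge0//.
by move=> x; rewrite ler_pdivlMr// (lt_le_trans ltr01)// oneDsqr_ge1.
Qed.

Lemma schwartz_Lmu f mu : - (1 / 2) <= mu -> schwartz f -> Lmu mu 1 f.
Proof.
move=> hmu sf.
have mf : cmeasurable f.
  by have [] := schwartz_continuous sf; exact: continuous_cmeasurable.
split=> //; rewrite Lmu_norm1E.
have p0 : 0 <= 2 * mu + 1 by lra.
have [C C0 hC] := schwartz_weight_decay p0 sf.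
have V0 x : 0 <= (oneDsqr x)^-1 :> R.
  by rewrite invr_ge0 (le_trans ler01)// oneDsqr_ge1.
have mV : measurable_fun [set: lebesgueType R]
    (fun x : lebesgueType R => (oneDsqr (x : R))^-1).
  by apply: continuous_measurable_lebesgueType; exact: continuous_oneDsqrV.
apply: (@le_lt_trans _ _ (\int[leb]_x (C%:E * ((oneDsqr x)^-1)%:E))%E).
  apply: ge0_le_integral => //.
  - by move=> x _; rewrite lee_fin mulr_ge0 ?cmod_ge0 ?powR_ge0.
  - apply/measurable_EFinP; apply: measurable_funM; first exact: measurable_cmod.
    exact: (cmeasurable_weight _).1.
  - by apply/measurable_EFinP; apply: measurable_funM.
  - by move=> x _; rewrite -EFinM lee_fin.
rewrite ge0_integralZl//.
- by rewrite lte_mul_pinfty ?lee_fin// integral_oneDsqrV_lty.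
- exact/measurable_EFinP.
Qed.

End Schwartz.

(** * The quadratic-phase Dunkl transform *)

Theorem theorem3p3 (R : realType) (a b c d e mu : R)
    (hb : b != 0) (hmu : - (1 / 2) <= mu) :
  (forall f : R -> R[i], Lmu mu 1 f ->
     continuous (qp_dunkl_transform a b c d e mu f : R -> (R[i] : numFieldType))
     /\
     (forall w : R,
        ((cmod (qp_dunkl_transform a b c d e mu f w))%:E
         <= (c_ mu / cmod ('i%C * b%:C) `^ (mu + 1))%:E * Lmu_norm mu 1 f)%E))
  /\
  (forall f : R -> R[i], schwartz f ->
     forall w : R,
       qp_dunkl_transform a b c d e mu f w =
       (cpow ('i%C * b%:C) (mu + 1)%:C)^-1 *
       cexp (- 'i%C * (c * w ^+ 2 + e * w)%:C) *
       dunkl_transform mu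
         (fun v => cexp (- 'i%C * (a * v ^+ 2 + d * v)%:C) * f v) (w / b)).
Proof.
have m1 : -1 < mu by lra.
have ib0 : 'i%C * b%:C != 0 :> R[i].
  rewrite mulf_neq0//; first by rewrite eq_complex /= oner_eq0 andbF.
  by rewrite eq_complex /= (negbTE hb).
split=> f => [Lf|sf w].
- have mK w := cmeasurable_qp_kernel a b c d e w m1.
  have K1 w v := cmod_qp_kernel_le1 a b c d e w v hmu.
  set k := (c_ mu)%:C / cpow ('i%C * b%:C) (mu + 1)%:C.
  have qpE w : qp_dunkl_transform a b c d e mu f w =
      k * cintegral (weighted mu (qp_kernel a b c d e mu w) f) by [].
  split=> [|w].
  + have cK v := continuous_qp_kernel a b c d e v m1.
    have [cR cI] := continuous_integral_weighted mK K1 cK Lf.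
    apply: continuous_complex.
    * under eq_fun do rewrite qpE ReM.
      by move=> w; apply: cvgB; apply: cvgM;
        [exact: cvg_cst|exact: cR|exact: cvg_cst|exact: cI].
    * under eq_fun do rewrite qpE ImM.
      by move=> w; apply: cvgD; apply: cvgM;
        [exact: cvg_cst|exact: cI|exact: cvg_cst|exact: cR].
  + rewrite qpE cmodM EFinM {1}/k cmodM cmodV cmod_cpow// cmod_real ger0_norm.
      rewrite lee_wpmul2l ?lee_fin ?divr_ge0 ?powR_ge0 ?c_ge0//.
      exact: le_cmod_cintegral_weighted.
    exact: c_ge0.
- have Lf := schwartz_Lmu hmu sf.
  pose K := qp_kernel a b 0 d 0 mu w.
  have iK : cintegrable (weighted mu K f).
    apply: cintegrable_weighted Lf; first exact: cmeasurable_qp_kernel.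
    by move=> v; exact: cmod_qp_kernel_le1.
  have -> : qp_dunkl_transform a b c d e mu f w =
      (c_ mu)%:C / cpow ('i%C * b%:C) (mu + 1)%:C *
      (cexp (- 'i%C * (c * w ^+ 2 + e * w)%:C) * cintegral (weighted mu K f)).
    rewrite -cintegralZl//; congr (_ * _); congr cintegral; apply/funext => v.
    by rewrite qp_kernel_split /weighted !mulrA.
  have -> : dunkl_transform mu
      (fun v => cexp (- 'i%C * (a * v ^+ 2 + d * v)%:C) * f v) (w / b) =
      (c_ mu)%:C * cintegral (weighted mu K f).
    congr (_ * _); congr cintegral; apply/funext => v.
    by rewrite /weighted /K qp_kernel_phase mulrA [cexp _ * dunklE _ _ _]mulrC.
  move: (cintegral _) (cexp _) (cpow _ _)^-1 (c_ mu)%:C => I P z k.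
  by rewrite [k * z]mulrC mulrACA.
Qed.
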